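(* Let $kl\in B$, let $x^*$ be a feasible solution of $(P_{|kl})$ and let $u^*$ be an optimal solution of $(D)$. Then [$x^*$ is optimal for $(P_{|kl})$ and $r_{kl}(u^* )=R_{kl}$] if and only if $x^*$ and $u^*$ satisfy the $kl$-excluded complementary slackness conditions.
   Context: Setting. $X_1,\dots,X_n$ are variables with finite domains $D(X_i)\subset\mathbb{Z}$, and $C$ is a constraint on them, i.e. a set of allowed tuples. A support for $C$ is an allowed tuple $\langle a_1,\dots,a_n\rangle$ with $a_i\in D(X_i)$ for all $i$. $B=\{ij : 1\le i\le n,\ j\in D(X_i)\}$ is the (finite) set of variable/value pairs, where $ij$ is short for $(i,j)$. The characteristic vector of a support is $x\in\{0,1\}^{B}$ with $x_{ij}=1$ iff $a_i=j$; $\mathcal{S}$ is the set of characteristic vectors of the supports of $C$. Each pair has a cost $c_{ij}\in\mathbb{Z}$. Ideal formulation (standing assumption): $A$ is a real $m\times|B|$ matrix (with columns $A_{ij}$, $ij\in B$, and rows $A^{\intercal}_1,\dots,A^{\intercal}_m$) and $b\in\mathbb{R}^m$ are such that $\{x\in\mathbb{R}^{B}_+ : Ax\ge b\}=\mathrm{conv}(\mathcal{S})$. $(P)$: $z^*=\min\{cx : Ax\ge b,\ x\in\mathbb{R}^B_+\}$; $(D)$: $\max\{ub : uA\le c,\ u\in\mathbb{R}^m_+\}$. For $kl\in B$, $(P_{|kl})$ is $(P)$ with the additional constraint $x_{kl}=1$, with optimal value $z^*_{|kl}$. Feasibility (standing assumption): every pair of $B$ belongs to at least one support of $C$; hence $(P)$,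 $(D)$ and all $(P_{|kl})$ are feasible and bounded. For feasible $u$ of $(D)$ the reduced cost of $kl$ is $r_{kl}(u)=c_{kl}-uA_{kl}$. $R_{kl}=z^*_{|kl}-z^*$. $kl$-excluded complementary slackness conditions for $x$ (feasible for $(P)$) and $u$ (feasible for $(D)$): for every $ij\in B\setminus\{kl\}$, $uA_{ij}=c_{ij}$ or $x_{ij}=0$; and for every $1\le p\le m$, $A^{\intercal}_p x=b_p$ or $u_p=0$. *)

(* Defs.v *)
From mathcomp Require Import all_boot all_order all_algebra finmap.
From mathcomp Require Import all_classical all_reals all_analysis.

Set Implicit Arguments.
Unset Strict Implicit.
Unset Printing Implicit Defensive.

Import Order.TTheory GRing.Theory Num.Theory.

Local Open Scope classical_set_scope.
Local Open Scope ring_scope.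

(* The set B of variable/value pairs: ij : pairs D has variable [tag ij] and
   value [val (tagged ij)]. Vectors of R^B are indexed by 'I_#|B|; the
   coordinate of the pair ij is [enum_rank ij]. *)
Definition pairs (n : nat) (D : 'I_n -> {fset int}) : finType :=
  {i : 'I_n & D i}.

Section Constraint.
Variables (n : nat) (D : 'I_n -> {fset int}) (C : set (n.-tuple int)).

Definition supports : set (n.-tuple int) :=
  [set a | C a /\ forall i, tnth a i \in D i].

Definition has_pair (a : n.-tuple int) (ij : pairs D) : bool :=
  tnth a (tag ij) == val (tagged ij).

Definition char_vector (R : realType) (a : n.-tuple int)
    : 'cV[R]_#|pairs D| :=
  \col_r (has_pair a (enum_val r))%:R.

Definition char_vectors (R : realType) : set 'cV[R]_#|pairs D| :=
  char_vector R @` supports.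

End Constraint.

Arguments supports {n} D C.
Arguments char_vectors {n} D C R.

Definition convex_hull (R : realType) (M : lmodType R) (S : set M) : set M :=
  smallest (@convex_set R M) S.

Section Optimization.
Variables (R : realType) (T : Type) (f : T -> R) (F : set T).

Definition minimizers : set T :=
  [set x | F x /\ forall y, F y -> f x <= f y].

Definition maximizers : set T :=
  [set x | F x /\ forall y, F y -> f y <= f x].

(* The infimum, which is the minimum whenever a minimizer exists. *)
Definition min_value : R := inf (f @` F).

Lemma min_valueE x : minimizers x -> min_value = f x.
Proof.
move=> [Fx xmin]; apply/eqP; rewrite eq_le; apply/andP; split.
  by apply: ge_inf; [exists (f x) => _ [y Fy <-]; exact: xmin | exists x].
by apply: lb_le_inf; [exists (f x), x | move=> _ [y Fy <-]; exact: xmin].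
Qed.

End Optimization.

Section LinearPrograms.
Variables (R : realType) (n : nat) (D : 'I_n -> {fset int}).
Variables (m : nat) (A : 'M[R]_(m, #|pairs D|)) (b : 'cV[R]_m).
Variable c : pairs D -> int.
Implicit Types (x : 'cV[R]_#|pairs D|) (u : 'rV[R]_m) (kl : pairs D).

Definition cost_row : 'rV[R]_#|pairs D| := \row_r (c (enum_val r))%:~R.

Definition primal_feasible : set 'cV[R]_#|pairs D| :=
  [set x | (forall p, b p 0 <= (A *m x) p 0) /\ (forall r, 0 <= x r 0)].

Definition restricted_feasible kl : set 'cV[R]_#|pairs D| :=
  [set x | primal_feasible x /\ x (enum_rank kl) 0 = 1].

Definition dual_feasible : set 'rV[R]_m :=
  [set u | (forall r, (u *m A) 0 r <= cost_row 0 r) /\ (forall p, 0 <= u 0 p)].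

Definition primal_cost x : R := (cost_row *m x) 0 0.

Definition dual_value u : R := (u *m b) 0 0.

Definition restricted_optimal kl : set 'cV[R]_#|pairs D| :=
  minimizers primal_cost (restricted_feasible kl).

Definition dual_optimal : set 'rV[R]_m := maximizers dual_value dual_feasible.

Definition zstar : R := min_value primal_cost primal_feasible.

Definition zstar_restricted kl : R :=
  min_value primal_cost (restricted_feasible kl).

Definition reduced_cost kl u : R :=
  (c kl)%:~R - (u *m col (enum_rank kl) A) 0 0.

(* The quantity R_{kl}. *)
Definition exact_reduced_cost kl : R := zstar_restricted kl - zstar.

Definition excluded_slackness kl x u : Prop :=
  (forall ij, ij != kl ->
     (u *m col (enum_rank ij) A) 0 0 = (c ij)%:~R \/ x (enum_rank ij) 0 = 0) /\
  (forall p, (row p A *m x) 0 0 = b p 0 \/ u 0 p = 0).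

End LinearPrograms.

(* Main.v *)
(* For x feasible for (P) and u feasible for (D),
     c x - u b = sum_ij r_ij(u) x_ij + sum_p u_p (A x - b)_p
   with nonnegative summands.  When x_kl = 1 the summand at kl is r_kl(u), so
   c x >= u b + r_kl(u), with equality exactly under the kl-excluded
   complementary slackness conditions.  Strong duality (u b = z* for optimal u)
   turns this into the claim; it follows from Farkas' lemma, proved by
   Bartl's induction on the number of inequalities. *)
Require Import Defs.
From mathcomp Require Import all_boot all_order all_algebra finmap.
From mathcomp Require Import all_classical all_reals all_analysis.
From mathcomp Require Import lra.

Set Implicit Arguments.
Unset Strict Implicit.
Unset Printing Implicit Defensive.

Import Order.TTheory GRing.Theory Num.Theory.

Local Open Scope classical_set_scope.
Local Open Scope ring_scope.

(** * Farkas' lemma and strong duality *)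

Section LinearProgramming.
Variable R : realFieldType.

Lemma mulmx_rowcol n p (v : 'rV[R]_n) (w : 'cV[R]_n) (a : 'rV[R]_p) :
  v *m w *m a = (v *m w) 0 0 *: a.
Proof. by rewrite [v *m w]mx11_scalar mul_scalar_mx -mx11_scalar. Qed.

Lemma mulmx_ge0 n (v : 'rV[R]_n) (w : 'cV[R]_n) :
  (forall i, 0 <= v 0 i) -> (forall i, 0 <= w i 0) -> 0 <= (v *m w) 0 0.
Proof. by move=> v0 w0; rewrite mxE sumr_ge0 // => i _; rewrite mulr_ge0. Qed.

Lemma farkas n m (M : 'M[R]_(m, n)) (c : 'rV[R]_n) :
  (forall x : 'cV_n, (forall i, 0 <= (M *m x) i 0) -> 0 <= (c *m x) 0 0) ->
  exists2 l : 'rV_m, (forall i, 0 <= l 0 i) & c = l *m M.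
Proof.
elim: m M c => [|m IHm] M c Mc.
  exists 0 => [i|]; first by rewrite mxE.
  (* With no rows, [- c^T] satisfies every constraint, so - |c|^2 >= 0 and c = 0. *)
  have /Mc : forall i, 0 <= (M *m - c^T) i 0 by case.
  rewrite mul0mx mulmxN !mxE oppr_ge0 => c2_le0.
  have c2_ge0 j : true -> 0 <= c 0 j * c^T j 0.
    by rewrite mxE -expr2 sqr_ge0.
  apply/rowP => j; rewrite [RHS]mxE; apply/eqP.
  have /eqP : \sum_j c 0 j * c^T j 0 = 0.
    by apply/eqP; rewrite eq_le c2_le0 sumr_ge0.
  rewrite psumr_eq0// => /allP /(_ j (mem_index_enum _)).
  by rewrite mxE mulf_eq0 orbb.
rewrite -[m.+1]/(1 + m)%N in M Mc *.
rewrite -[M]vsubmxK in Mc *.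
move: (usubmx M) (dsubmx M) Mc => a N Mc.
(* If [N] alone implies c x >= 0, the row [a] gets multiplier 0. Otherwise some [z] has N z >= 0 and
   c z < 0, which forces a z < 0. *)
have [Nc|] := pselect (forall x : 'cV_n,
    (forall i, 0 <= (N *m x) i 0) -> 0 <= (c *m x) 0 0).
  have [l l0 ->] := IHm N c Nc.
  exists (row_mx 0 l); last by rewrite mul_row_col mul0mx add0r.
  by move=> i; rewrite mxE; case: splitP => j _; rewrite ?mxE.
move=> /existsNP[z /not_implyP[Nz /negP]]; rewrite -ltNge => cz.
have McE (x : 'cV_n) : 0 <= (a *m x) 0 0 -> (forall i, 0 <= (N *m x) i 0) ->
    0 <= (c *m x) 0 0.
  move=> ax Nx; apply: Mc => i; rewrite mul_col_mx mxE.
  by case: splitP => j _ //; rewrite ord1.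
have az : (a *m z) 0 0 < 0.
  by rewrite ltNge; apply/negP => /McE /(_ Nz); rewrite leNgt cz.
set d := (a *m z) 0 0 in az.
(* Projection along z onto the kernel of a. *)
pose P : 'M[R]_n := 1%:M - d^-1 *: (z *m a).
have aP : a *m P = 0.
  rewrite /P mulmxBr mulmx1 -scalemxAr mulmxA mulmx_rowcol scalerA.
  by rewrite mulVf ?lt_eqF// scale1r subrr.
have [x NPx|l l0] := IHm (N *m P) (c *m P).
  rewrite -mulmxA; apply: McE => [|i]; first by rewrite mulmxA aP mul0mx mxE.
  by rewrite mulmxA.
rewrite /P !mulmxBr !mulmx1 -!scalemxAr !mulmxA => cE.
(* Expanding c P = l N P gives c - l N = k a. Here k >= 0 because d < 0 and c z < 0 <= l N z. *)
pose k := d^-1 * ((c *m z) 0 0 - (l *m N *m z) 0 0).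
exists (row_mx k%:M l).
  move=> i; rewrite mxE; case: splitP => j _ //; rewrite ord1 mxE eqxx mulr1n.
  rewrite mulr_le0// ?invr_le0 ?ltW// subr_lt0 (lt_le_trans cz)//.
  by rewrite -mulmxA mulmx_ge0.
move: cE; rewrite !mulmx_rowcol mul_row_col mul_scalar_mx.
rewrite !scalerA => /eqP; rewrite subr_eq => /eqP {1}->.
by rewrite /k mulrBr scalerBl [RHS]addrC addrA addrAC.
Qed.

(** Farkas' lemma for the homogenized system yields [u] as the multipliers of the rows of [A]. Since
    [z] is any lower bound, an infimum can take its place. *)
Lemma strong_duality n m (A : 'M[R]_(m, n)) (b : 'cV[R]_m) (c : 'rV[R]_n)
    (x0 : 'cV[R]_n) (z : R) :
  let feasible (x : 'cV[R]_n) :=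
    (forall p, b p 0 <= (A *m x) p 0) /\ (forall r, 0 <= x r 0) in
  feasible x0 -> (forall x, feasible x -> z <= (c *m x) 0 0) ->
  exists u : 'rV[R]_m, [/\ forall r, (u *m A) 0 r <= c 0 r,
    forall p, 0 <= u 0 p & z <= (u *m b) 0 0].
Proof.
move=> feasible [Ax0 x00] zmin.
(* Homogenize with an extra variable t; t = 0 is the recession cone. *)
pose M := col_mx (row_mx A (- b)) (1%:M : 'M[R]_(n + 1)).
(* To verify: t z <= c x whenever x, t >= 0 and t b <= A x. *)
have [y My|l l0] := @farkas _ _ M (row_mx c (- z%:M)).
  rewrite -[y]vsubmxK; set x := usubmx y; set t := dsubmx y 0 0.
  have yE : dsubmx y = t%:M by exact: mx11_scalar.
  have y0 i : 0 <= y i 0.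
    by have := My (rshift m i); rewrite mul_col_mx col_mxEd mul1mx.
  have x_ge0 r : 0 <= x r 0 by rewrite mxE.
  have t_ge0 : 0 <= t by rewrite /t mxE.
  have Ax p : t * b p 0 <= (A *m x) p 0.
    have := My (lshift _ p); rewrite mul_col_mx col_mxEu -[y]vsubmxK.
    rewrite mul_row_col yE mul_mx_scalar scalerN mxE [X in _ + X]mxE.
    by rewrite [X in _ - X]mxE subr_ge0.
  rewrite mul_row_col yE mul_mx_scalar scalerN mxE [X in _ + X]mxE.
  rewrite [X in _ - X]mxE [_%:M _ _]mxE eqxx mulr1n subr_ge0.
  (* For t > 0, rescale: x / t is feasible. *)
  move: t_ge0; rewrite le_eqVlt => /predU1P[t0|t_gt0]; last first.
    rewrite -ler_pdivlMl//.
    have -> : t^-1 * (c *m x) 0 0 = (c *m (t^-1 *: x)) 0 0.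
      by rewrite -scalemxAr [RHS]mxE.
    apply: zmin; split=> [p|r]; last by rewrite mxE mulr_ge0// invr_ge0 ltW.
    by rewrite -scalemxAr mxE ler_pdivlMl.
  (* For t = 0, a negative c x would make the cost unbounded below along the ray from [x0] in
     direction [x]. *)
  rewrite -t0 mul0r leNgt; apply/negP => cx.
  have ray (s : R) : 0 <= s -> z <= (c *m x0) 0 0 + s * (c *m x) 0 0.
    move=> s0; have -> : (c *m x0) 0 0 + s * (c *m x) 0 0 =
        (c *m (x0 + s *: x)) 0 0.
      by rewrite mulmxDr -scalemxAr [RHS]mxE [X in _ = _ + X]mxE.
    apply: zmin; split=> [p|r]; last by rewrite !mxE addr_ge0// mulr_ge0// -mxE.
    rewrite mulmxDr -scalemxAr mxE [X in _ + X]mxE -[leLHS]addr0 lerD//.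
    by rewrite mulr_ge0// (le_trans _ (Ax p))// -t0 mul0r.
  have z_le : z <= (c *m x0) 0 0 by exact: zmin.
  set e := (c *m x) 0 0 in cx ray; set f := (c *m x0) 0 0 in z_le ray.
  (* At this step length the cost on the ray is z - 1, below the bound [z]. *)
  have /ray : 0 <= (z - f - 1) / e.
    by rewrite mulr_le0 ?invr_le0 ?(ltW cx)//; lra.
  by rewrite divfK ?lt_eqF//; lra.
(* The multipliers of the identity rows are the slacks in u A <= c and z <= u b. *)
rewrite -[l]hsubmxK mul_row_col mulmx1 mul_mx_row.
rewrite -[rsubmx l]hsubmxK add_row_mx => /eq_row_mx[cE zE].
exists (lsubmx l); split=> [r|p|].
- by rewrite cE [leRHS]mxE lerDl !mxE.
- by rewrite mxE.
- move/matrixP/(_ 0 0): zE; rewrite mulmxN !mxE eqxx mulr1n => zE.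
  by rewrite -lerN2 zE lerDl.
Qed.

End LinearProgramming.

(** * The duality gap in terms of reduced costs *)

Section ReducedCosts.
Variables (R : realType) (n : nat) (D : 'I_n -> {fset int}).
Variables (m : nat) (A : 'M[R]_(m, #|pairs D|)) (b : 'cV[R]_m).
Variable c : pairs D -> int.
Implicit Types (x : 'cV[R]_#|pairs D|) (u : 'rV[R]_m) (kl : pairs D).

Lemma reduced_costE ij u : reduced_cost A c ij u =
  cost_row R c 0 (enum_rank ij) - (u *m A) 0 (enum_rank ij).
Proof.
by rewrite /reduced_cost colE mulmxA -colE !mxE enum_rankK.
Qed.

Lemma reduced_cost_ge0 ij u : dual_feasible A c u -> 0 <= reduced_cost A c ij u.
Proof. by case=> uA _; rewrite reduced_costE subr_ge0. Qed.

Lemma duality_gapE x u : primal_cost c x - dual_value b u =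
  \sum_ij reduced_cost A c ij u * x (enum_rank ij) 0 +
  \sum_p u 0 p * ((A *m x) p 0 - b p 0).
Proof.
have -> : \sum_p u 0 p * ((A *m x) p 0 - b p 0) =
    (u *m (A *m x - b)) 0 0.
  by rewrite [RHS]mxE; apply: eq_bigr => p _; rewrite !mxE.
have -> : \sum_ij reduced_cost A c ij u * x (enum_rank ij) 0 =
    ((cost_row R c - u *m A) *m x) 0 0.
  rewrite [RHS]mxE (reindex _ (onW_bij _ (@enum_rank_bij _))) /=.
  by apply: eq_bigr => ij _; rewrite reduced_costE !mxE.
rewrite /primal_cost /dual_value mulmxBl mulmxBr mulmxA !mxE.
by rewrite addrA subrK.
Qed.

Lemma dual_value_le x u : primal_feasible A b x -> dual_feasible A c u ->
  dual_value b u <= primal_cost c x.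
Proof.
move=> [Ax x0] uF; rewrite -subr_ge0 duality_gapE addr_ge0// sumr_ge0// => i _.
  by rewrite mulr_ge0// reduced_cost_ge0.
by rewrite mulr_ge0// ?subr_ge0//; case: uF.
Qed.

(** Weak duality bounds the infimum [zstar] from below; strong duality, applied with [zstar] as the
    lower bound, gives a dual solution of at least that value, which [u] dominates. *)
Lemma zstar_dual x u : primal_feasible A b x -> dual_optimal A b c u ->
  zstar A b c = dual_value b u.
Proof.
move=> xF [uF umax]; apply/eqP; rewrite eq_le; apply/andP; split; last first.
  apply: lb_le_inf; first by exists (primal_cost c x), x.
  by move=> _ [y yF <-]; exact: dual_value_le.
have [y yF|v [vA v0 zv]] :=
    @strong_duality R _ _ A b (cost_row R c) x (zstar A b c) xF.
  apply: ge_inf; last by exists y.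
  by exists (dual_value b u) => _ [w wF <-]; exact: dual_value_le.
by apply: le_trans zv _; apply: umax.
Qed.

Lemma excluded_gapE kl x u : x (enum_rank kl) 0 = 1 ->
  primal_cost c x - dual_value b u - reduced_cost A c kl u =
  \sum_(ij | ij != kl) reduced_cost A c ij u * x (enum_rank ij) 0 +
  \sum_p u 0 p * ((A *m x) p 0 - b p 0).
Proof.
move=> xkl; rewrite duality_gapE (bigD1 kl)//= xkl mulr1 addrAC.
by rewrite [X in X - _ + _]addrC addrK.
Qed.

Lemma excluded_gap_ge0 kl x u : restricted_feasible A b kl x ->
  dual_feasible A c u ->
  0 <= primal_cost c x - dual_value b u - reduced_cost A c kl u.
Proof.
move=> [[Ax x0] xkl] uF; rewrite excluded_gapE// addr_ge0// sumr_ge0// => i _.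
  by rewrite mulr_ge0// reduced_cost_ge0.
by rewrite mulr_ge0// ?subr_ge0//; case: uF.
Qed.

(** A sum of nonnegative products vanishes exactly when each product has a zero factor. *)
Lemma excluded_gap_eq0 kl x u : restricted_feasible A b kl x ->
  dual_feasible A c u ->
  primal_cost c x - dual_value b u - reduced_cost A c kl u = 0 <->
  excluded_slackness A b c kl x u.
Proof.
move=> [[Ax x0] xkl] uF; rewrite excluded_gapE//.
have rx_ge0 ij : ij != kl -> 0 <= reduced_cost A c ij u * x (enum_rank ij) 0.
  by move=> _; rewrite mulr_ge0// reduced_cost_ge0.
have us_ge0 p : true -> 0 <= u 0 p * ((A *m x) p 0 - b p 0).
  by move=> _; rewrite mulr_ge0// ?subr_ge0//; case: uF.
split=> [/eqP|[rx us]]; last first.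
  rewrite !big1 ?addr0// => [p _|ij /rx[rij|->]]; last by rewrite mulr0.
    case: (us p) => [<-|->]; last by rewrite mul0r.
    by rewrite -row_mul [row _ _ _ _]mxE subrr mulr0.
  by rewrite /reduced_cost rij subrr mul0r.
rewrite paddr_eq0 ?sumr_ge0// !psumr_eq0// => /andP[/allP rx /allP us].
split=> [ij ijkl|p].
  have := rx ij (mem_index_enum _); rewrite ijkl/= mulf_eq0 subr_eq0.
  by case/orP => /eqP; [left|right].
have := us p (mem_index_enum _).
rewrite /= mulf_eq0 subr_eq0 -row_mul [row _ _ _ _]mxE.
by case/orP => /eqP; [right|left].
Qed.

End ReducedCosts.

Theorem theorem2 (R : realType) (n : nat) (D : 'I_n -> {fset int})
  (C : set (n.-tuple int)) (c : pairs D -> int)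
  (m : nat) (A : 'M[R]_(m, #|pairs D|)) (b : 'cV[R]_m)
  (ideal : primal_feasible A b = convex_hull (char_vectors D C R))
  (supported : forall ij : pairs D, exists2 a, supports D C a & has_pair a ij)
  (kl : pairs D) (x : 'cV[R]_#|pairs D|) (u : 'rV[R]_m)
  (hx : restricted_feasible A b kl x) (hu : dual_optimal A b c u) :
  (restricted_optimal A b c kl x /\
     reduced_cost A c kl u = exact_reduced_cost A b c kl) <->
  excluded_slackness A b c kl x u.
Proof.
have [[xF _] [uF _]] := (hx, hu).
rewrite -(excluded_gap_eq0 hx uF) /exact_reduced_cost (zstar_dual xF hu).
split=> [[xopt ->]|gap0].
  by rewrite /zstar_restricted (min_valueE xopt) subrr.
have xopt : restricted_optimal A b c kl x.
  (* The same dual value and reduced cost are subtracted for [x] and [y], so comparing the gaps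
     compares the costs. *)
  split=> // y yF; have := excluded_gap_ge0 yF uF.
  by rewrite -gap0 -!addrA lerD2r.
split=> //; rewrite /zstar_restricted (min_valueE xopt).
by apply/esym/eqP; rewrite -subr_eq0 gap0.
Qed.
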